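(* Let $p$ be a prime and $t\geq 2$ an integer. Then the zero divisor graph $\Gamma(\mathbb{Z}_{p^t})$ is Laplacian integral, and all the eigenvalues of the vertex weighted Laplacian matrix $\mathbf{L}(\Upsilon_{p^t})$ are integers.
   Context: The zero divisor graph $\Gamma(\mathbb{Z}_n)$ is the simple graph whose vertices are the nonzero zero divisors of $\mathbb{Z}_n$ (nonzero $x$ such that $xy=0$ for some nonzero $y$), two distinct vertices $x,y$ being adjacent iff $xy=0$ in $\mathbb{Z}_n$. For a finite simple graph $G$, the Laplacian matrix is $L(G)=D(G)-A(G)$ ($D(G)$ the diagonal degree matrix, $A(G)$ the adjacency matrix); $G$ is Laplacian integral if all eigenvalues of $L(G)$ are integers. A proper divisor of $n$ is an integer $d$ with $1<d<n$ and $d\mid n$. Let $d_1,\ldots,d_k$ be the distinct proper divisors of $n$. The graph $\Upsilon_n$ is the simple graph with vertices $d_1,\ldots,d_k$, two distinct vertices $d_i,d_j$ being adjacent iff $n\mid d_id_j$. With $\phi$ Euler's totient function, $\mathbf{L}(\Upsilon_n)$ is the $k\times k$ matrix whose $(i,j)$ entry for $i\neq j$ is $-\phi(n/d_j)$ if $d_i\sim d_j$ in $\Upsilon_n$ and $0$ otherwise, and whose $(j,j)$ entry is $M_{d_j}=\sum_{d_i\sim d_j}\phi(n/d_i)$, the sum over the neighbours $d_i$ of $d_j$ in $\Upsilon_n$ (equal to $0$ if there are none). *)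

(* Defs.v *)
From HB Require Import structures.
From mathcomp Require Import all_boot all_order all_algebra.

Set Implicit Arguments.
Unset Strict Implicit.
Unset Printing Implicit Defensive.

Import Order.TTheory GRing.Theory Num.Theory.
Local Open Scope ring_scope.

Record simple_graph := SimpleGraph {
  vertex :> finType;
  adj : rel vertex;
  adj_sym : symmetric adj;
  adj_irrefl : irreflexive adj
}.

Definition degree (G : simple_graph) (x : G) : nat := #|[set y | adj x y]|.

(* Matrices indexed by vertices use the enumeration of the vertex type. *)
Definition adjacency_mx (R : nzRingType) (G : simple_graph) : 'M[R]_#|G| :=
  \matrix_(i, j) (adj (enum_val i) (enum_val j))%:R.

Definition degree_mx (R : nzRingType) (G : simple_graph) : 'M[R]_#|G| :=
  diag_mx (\row_i (degree (enum_val i))%:R).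

Definition laplacian_mx (R : nzRingType) (G : simple_graph) : 'M[R]_#|G| :=
  degree_mx R G - adjacency_mx R G.

(* C is an arbitrary algebraically closed field with a conjugation, such as
   the complex numbers, so no eigenvalue is missed. *)
Definition integral_spectrum (C : numClosedFieldType) (n : nat)
    (A : 'M[C]_n) : Prop :=
  forall a : C, eigenvalue A a -> exists m : int, a = m%:~R.

Definition laplacian_integral (C : numClosedFieldType) (G : simple_graph) :
    Prop :=
  integral_spectrum (laplacian_mx C G).

(* 'Z_n is the ring of integers mod n only when 1 < n. *)
Definition nonzero_zero_divisor (n : nat) (x : 'Z_n) : bool :=
  (x != 0) && [exists y : 'Z_n, (y != 0) && (x * y == 0)].

Definition zdg_vertex (n : nat) : finType :=
  {x : 'Z_n | nonzero_zero_divisor x}.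

Definition zdg_adj (n : nat) : rel (zdg_vertex n) :=
  fun x y => (x != y) && (val x * val y == 0 :> 'Z_n).

Lemma zdg_adj_sym (n : nat) : symmetric (@zdg_adj n).
Proof. by move=> x y; rewrite /zdg_adj eq_sym mulrC. Qed.

Lemma zdg_adj_irrefl (n : nat) : irreflexive (@zdg_adj n).
Proof. by move=> x; rewrite /zdg_adj eqxx. Qed.

Definition zero_divisor_graph (n : nat) : simple_graph :=
  SimpleGraph (@zdg_adj_sym n) (@zdg_adj_irrefl n).

Definition proper_divisor (n d : nat) : bool := (1 < d < n)%N && (d %| n)%N.

Definition upsilon_vertex (n : nat) : finType :=
  {d : 'I_n | proper_divisor n d}.

Definition upsilon_adj (n : nat) : rel (upsilon_vertex n) :=
  fun d e => (d != e) && (n %| val d * val e)%N.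

Lemma upsilon_adj_sym (n : nat) : symmetric (@upsilon_adj n).
Proof. by move=> d e; rewrite /upsilon_adj eq_sym mulnC. Qed.

Lemma upsilon_adj_irrefl (n : nat) : irreflexive (@upsilon_adj n).
Proof. by move=> d; rewrite /upsilon_adj eqxx. Qed.

Definition upsilon_graph (n : nat) : simple_graph :=
  SimpleGraph (@upsilon_adj_sym n) (@upsilon_adj_irrefl n).

Definition upsilon_weight (n : nat) (d : upsilon_graph n) : nat :=
  totient (n %/ val d).

Definition weighted_laplacian_mx (R : nzRingType) (n : nat) :
    'M[R]_#|upsilon_graph n| :=
  \matrix_(i, j)
    if i == j then
      (\sum_(d : upsilon_graph n | adj d (enum_val j)) upsilon_weight d)%:R
    else if adj (enum_val i) (enum_val j) then
      - (upsilon_weight (enum_val j))%:R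
    else 0.

(* Main.v *)
(** Both graphs are threshold graphs: with [v = logn p], distinct vertices [x]
    and [y] are adjacent iff [t <= v x + v y].  Hence every nonempty set [S] of
    vertices contains a vertex [x] that is either adjacent to all the others or
    to none of them.  Let [f] be an eigenfunction on [S] of the weighted
    Laplacian, for an eigenvalue [a != 0]; then [f] has weighted sum [0].  If
    [x] is isolated, then [f x = 0]; if [x] is dominating, then either [f x = 0]
    or [a] is the total weight of [S].  When [f x = 0], deleting [x] leaves an
    eigenfunction for [a] or [a - w x] respectively, and one concludes by
    induction on [S]. *)
Require Import Defs.
From HB Require Import structures.
From mathcomp Require Import all_boot all_order all_algebra.
From mathcomp Require Import ring.

Set Implicit Arguments.
Unset Strict Implicit.
Unset Printing Implicit Defensive.

Import Order.TTheory GRing.Theory Num.Theory.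
Local Open Scope ring_scope.

Definition threshold (T : finType) (e : rel T) (v : T -> nat) (t : nat) :=
  forall x y, e x y = (x != y) && (t <= v x + v y)%N.

Lemma threshold_sym (T : finType) (e : rel T) (v : T -> nat) (t : nat) :
  threshold e v t -> symmetric e.
Proof. by move=> he x y; rewrite !he eq_sym addnC. Qed.

(** Take [x] maximizing and [y] minimizing [v] on [S]. If [t <= v x + v y], then [x] is adjacent to
    all other vertices of [S]; otherwise [y] is adjacent to none. *)
Lemma threshold_dominating_or_isolated (T : finType) (e : rel T)
    (v : T -> nat) (t : nat) (S : {set T}) :
  threshold e v t -> S != set0 ->
  exists2 x, x \in S & exists b, {in S, forall y, e x y = b && (x != y)}.
Proof.
move=> he /set0Pn[x0 Sx0].
have [x Sx maxx] := arg_maxnP v Sx0; have [y Sy miny] := arg_minnP v Sx0.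
have [le_t|lt_t] := leqP t (v x + v y).
  exists x => //; exists true => z Sz.
  by rewrite he (leq_trans le_t) ?andbT // leq_add2l miny.
exists y => //; exists false => z Sz.
rewrite he leqNgt (leq_ltn_trans _ lt_t) ?andbF // addnC leq_add2r.
exact: maxx.
Qed.

Section Eigenfunctions.
Variables (R : idomainType) (T : finType) (e : rel T) (w : T -> nat).

(** Action on column vectors of the weighted Laplacian of the subgraph induced on [S]. *)
Definition laplacian_on (S : {set T}) (f : T -> R) (j : T) : R :=
  \sum_(i in S | e i j) (w i)%:R * (f j - f i).

(** The summand [w i * w j * (f j - f i)] is antisymmetric in [i] and [j]. *)
Lemma sum_laplacian_on (S : {set T}) (f : T -> R) : symmetric e ->
  \sum_(j in S) (w j)%:R * laplacian_on S f j = 0.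
Proof.
move=> e_sym.
have sumF : \sum_(j in S) \sum_(i in S | e i j) (w i)%:R * (w j)%:R * f j =
            \sum_(j in S) \sum_(i in S | e i j) (w i)%:R * (w j)%:R * f i.
  rewrite (exchange_big_dep (mem S)) /=; last by move=> i j _ /andP[].
  apply: eq_bigr => i Si; apply: eq_big => [j | j _]; last by ring.
  by rewrite Si e_sym.
rewrite (eq_bigr (fun j =>
  \sum_(i in S | e i j) (w i)%:R * (w j)%:R * f j -
  \sum_(i in S | e i j) (w i)%:R * (w j)%:R * f i)).
  by rewrite sumrB sumF subrr.
by move=> j _; rewrite -sumrB mulr_sumr; apply: eq_bigr => i _; ring.
Qed.

Lemma threshold_eigenvalue_int (v : T -> nat) (t : nat) (S : {set T})
    (f : T -> R) (a : R) :
  threshold e v t ->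
  {in S, forall j, laplacian_on S f j = a * f j} ->
  (exists2 x, x \in S & f x != 0) -> exists m : int, a = m%:~R.
Proof.
move=> he.
(* The function [f] stays fixed in the induction; only [S] and [a] vary. *)
have [n] := ubnP #|S|; elim: n S a => // n IHn S a leSn eigS [x0 Sx0 fx0].
have [->|a0] := eqVneq a 0; first by exists 0.
have [|x Sx [b xP]] := threshold_dominating_or_isolated he (S := S).
  by apply/set0Pn; exists x0.
have e_sym := threshold_sym he.
have sumS : \sum_(j in S) (w j)%:R * f j = 0.
  apply: (mulfI a0); rewrite mulr0 mulr_sumr.
  apply: etrans (sum_laplacian_on S f e_sym).
  by apply: eq_bigr => j Sj; rewrite eigS // mulrCA.
have [fx|fx] := eqVneq (f x) 0; last first.
  have := eigS _ Sx; case: b xP => xP; last first.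
    (* Isolated [x]: the sum is empty, so [a * f x = 0], a contradiction. *)
    rewrite /laplacian_on big_pred0 => [/esym/eqP|i].
      by rewrite mulf_eq0 (negPf a0) (negPf fx).
    by case Si: (i \in S); rewrite //= e_sym xP.
  (* Dominating [x]: the term [i = x] vanishes, so the sum may run over all of [S]; by [sumS] it is
     the total weight times [f x]. *)
  have -> : laplacian_on S f x = \sum_(i in S) (w i)%:R * (f x - f i).
    rewrite [RHS](bigD1 x) //= subrr mulr0 add0r; apply: eq_bigl => i.
    by case Si: (i \in S); rewrite //= e_sym xP // eq_sym.
  under eq_bigr do rewrite mulrBr.
  rewrite sumrB sumS subr0 -mulr_suml => /(mulIf fx) <-.
  by exists (\sum_(i in S) w i)%N; rewrite -pmulrn natr_sum.
have leS'n : (#|S :\ x| < n)%N by rewrite [#|S|](cardsD1 x) Sx in leSn.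
have [||m am] := IHn (S :\ x) (a - (b * w x)%:R) leS'n.
- move=> j /setD1P[jx Sj].
  (* As [f x = 0], deleting [x] removes exactly [b * w x * f j] from the Laplacian at [j]. *)
  rewrite mulrBl -eigS // {2}/laplacian_on (bigID (pred1 x)) /=.
  rewrite (_ : \sum_(i | _ && (i == x)) _ = (b * w x)%:R * f j); last first.
    case: b xP => xP.
      rewrite (big_pred1 x) => [|i /=]; first by rewrite fx subr0 mul1n.
      by case: eqP => [->|_]; rewrite ?andbF // Sx xP // eq_sym jx.
    rewrite big_pred0 ?mul0r // => i /=.
    by case: eqP => [->|_]; rewrite ?andbF // Sx xP.
  rewrite addrC addrK; apply: eq_bigl => i.
  by rewrite !inE -!andbA andbC -andbA.
- exists x0 => //; rewrite !inE Sx0 andbT.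
  by apply: contraNneq fx0 => ->; rewrite fx.
by exists (m + (b * w x)%N); rewrite rmorphD /= -am subrK.
Qed.

End Eigenfunctions.

(** Common form of both matrices: weight 1 gives [laplacian_mx], and [upsilon_weight] gives
    [weighted_laplacian_mx]. *)
Definition vertex_weighted_laplacian_mx (R : nzRingType) (G : simple_graph)
    (w : G -> nat) : 'M[R]_#|G| :=
  \matrix_(i, j)
    if i == j then (\sum_(x : G | adj x (enum_val j)) w x)%:R
    else if adj (enum_val i) (enum_val j) then - (w (enum_val j))%:R
    else 0.

Lemma laplacian_mxE (R : nzRingType) (G : simple_graph) :
  laplacian_mx R G = vertex_weighted_laplacian_mx R (fun _ : G => 1%N).
Proof.
apply/matrixP => i j; rewrite !mxE; have [->|] := eqVneq i j.
  rewrite adj_irrefl subr0 mulr1n sum1_card /degree; congr (_%:R).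
  by rewrite -!sum1_card; apply: eq_bigl => x; rewrite inE adj_sym.
by rewrite mulr0n sub0r; case: ifP => _; rewrite ?oppr0.
Qed.

Lemma threshold_integral_spectrum (C : numClosedFieldType) (G : simple_graph)
    (w v : G -> nat) (t : nat) :
  (forall x, 0 < w x)%N -> threshold (@adj G) v t ->
  integral_spectrum (vertex_weighted_laplacian_mx C w).
Proof.
move=> w_gt0 he a /eigenvalueP[u uA u0].
have w0 x : (w x)%:R != 0 :> C by rewrite pnatr_eq0 -lt0n.
(* [eigenvalue] concerns left eigenvectors; dividing by the weights turns
   them into eigenfunctions of the Laplacian operator. *)
pose f x := u 0 (enum_rank x) / (w x)%:R.
have uE x : u 0 (enum_rank x) = (w x)%:R * f x by rewrite mulrC divfK.
apply: (threshold_eigenvalue_int (w := w) (S := setT) (f := f) he).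
(* Multiplied by [w y], the equation at [y] becomes the entry at [y] of [uA]. *)
- move=> y _; apply: (mulfI (w0 y)).
  rewrite mulrCA -uE; have /matrixP/(_ 0 (enum_rank y)) := uA.
  rewrite !mxE => <-.
  rewrite (reindex (@enum_rank G)) /=; last first.
    by exists enum_val => ? _; rewrite ?enum_rankK ?enum_valK.
  rewrite (bigD1 y) //= mxE eqxx enum_rankK uE natr_sum.
  rewrite [X in _ + X](eq_bigr (fun x =>
    if adj x y then - ((w y)%:R * ((w x)%:R * f x))
    else 0)); last first.
    move=> x xy; rewrite mxE (inj_eq enum_rank_inj) (negPf xy) !enum_rankK uE.
    by case: ifP => _; ring.
  rewrite -big_mkcondr /= /laplacian_on mulr_sumr.
  rewrite [X in _ + X](eq_bigl (fun x => adj x y)) => [|x]; last first.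
    by case: eqP => [->|//]; rewrite adj_irrefl.
  rewrite mulr_sumr -big_split /=; apply: eq_big => [x|x _]; last by ring.
  by rewrite inE.
have [i ui] : exists i, u 0 i != 0.
  by apply/existsP; apply: contraNT u0 => /existsPn h; apply/eqP/rowP => i;
    rewrite mxE; apply/eqP; rewrite -[_ == _]negbK h.
exists (enum_val i); rewrite ?inE // /f enum_valK.
by rewrite mulf_neq0 ?invr_neq0.
Qed.

(** A product vanishes iff [p ^ t] divides the product of the representatives, which are positive,
    so their valuations add. *)
Lemma threshold_zero_divisor_graph (p t : nat) : prime p -> (0 < t)%N ->
  threshold (@adj (zero_divisor_graph (p ^ t)))
    (fun x => logn p (val x : 'Z_(p ^ t))) t.
Proof.
move=> pr_p t_gt0 [x hx] [y hy] /=; rewrite /zdg_adj /=; congr (_ && _).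
have pt_gt1 : (1 < p ^ t)%N by rewrite -{1}(expn0 p) ltn_exp2l ?prime_gt1.
have gt0 (z : 'Z_(p ^ t)) : nonzero_zero_divisor z -> (0 < z)%N.
  by case/andP=> z0 _; rewrite lt0n.
rewrite -lognM ?gt0 // -pfactor_dvdn ?muln_gt0 ?gt0 //.
rewrite -val_eqE /= /dvdn; congr (_ %% _ == 0)%N; exact: Zp_cast.
Qed.

Lemma threshold_upsilon_graph (p t : nat) : prime p ->
  threshold (@adj (upsilon_graph (p ^ t)))
    (fun d => logn p (val d : 'I_(p ^ t))) t.
Proof.
move=> pr_p [d hd] [e he] /=; rewrite /upsilon_adj /=; congr (_ && _).
have gt0 (z : 'I_(p ^ t)) : proper_divisor (p ^ t) z -> (0 < z)%N.
  by case/andP=> /andP[/ltnW].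
by rewrite -lognM ?gt0 // -pfactor_dvdn ?muln_gt0 ?gt0.
Qed.

Lemma upsilon_weight_gt0 (n : nat) (d : upsilon_graph n) :
  (0 < upsilon_weight d)%N.
Proof.
rewrite /upsilon_weight totient_gt0.
have /andP[/andP[d1 dn] _] := valP d.
by rewrite divn_gt0 (ltnW d1, ltnW dn).
Qed.

Theorem corollary4p4 (C : numClosedFieldType) (p t : nat)
    (hp : prime p) (ht : (2 <= t)%N) :
  laplacian_integral C (zero_divisor_graph (p ^ t)%N) /\
  integral_spectrum (weighted_laplacian_mx C (p ^ t)%N).
Proof.
split.
  rewrite /laplacian_integral laplacian_mxE.
  apply: threshold_integral_spectrum (threshold_zero_divisor_graph hp _) => //.
  exact: ltnW.
exact: threshold_integral_spectrum (@upsilon_weight_gt0 _)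
  (threshold_upsilon_graph hp).
Qed.
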